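(* Let $\langle \ell, p\rangle$ be a problem with agent set $N=\{1,\dots,n\}$, let $x^*\in X$ be the efficient profile, i.e. $\mathbb{C}(x^* )\le \mathbb{C}(x)$ for all $x\in X$, and let $\phi$ be a solution. Then $\phi$ implements $x^*$ if and only if, for each agent $i\in N$, \[ \phi(i,i) = \ell_i + \sum_{k>i}\Big(\prod_{i<j\le k} p_j(x^*_j)\Big)\ell_k . \]
   Context: Agents: $N=\{1,\dots,n\}$, ordered. A problem $\langle \ell,p\rangle$ consists of losses $\ell=(\ell_1,\dots,\ell_n)\in\mathbb{R}^n_{>0}$ and technologies $p=(p_i)_{i\in N}$, where each $p_i:\mathbb{R}_{\ge 0}\to[0,1]$ is strictly increasing, strictly concave, continuous on $[0,\infty)$ and differentiable on $(0,\infty)$, with $p_i(0)=0$ and $p_i'(x_i)\to\infty$ as $x_i\to 0$. A profile is $x=(x_i)_{i\in N}\in X=\mathbb{R}^n_{\ge 0}$. A solution is a function $\phi:N\times N\to\mathbb{R}_{\ge 0}$ with $\phi(i,j)=0$ for all $j<i$ and (balance) $\sum_{j\ge i}\phi(i,j)=\sum_{j\ge i}\ell_j$ for all $i\in N$. Given $\phi$, the expected cost of agent $k$ at profile $x$ is \[ C_k(x;\phi)=\sum_{j<k}\Big(\prod_{i<j}p_i(x_i)\Big)(1-p_j(x_j))\,\phi(j,k)+\Big(\prod_{i<k}p_i(x_i)\Big)(1-p_k(x_k))\,\phi(k,k)+x_k \] (empty sums are $0$, empty products are $1$). The solution $\phi$ induces the simultaneous-move game in which each agent $k$ chooses $x_k\in\mathbb{R}_{\ge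 0}$ to minimize $C_k(\cdot;\phi)$. The solution $\phi$ implements a profile $x$ if $x$ is the unique (pure-strategy) Nash equilibrium of this game. The total cost is $\mathbb{C}(x)=\sum_{j\in N}\big(1-\prod_{i\le j}p_i(x_i)\big)\ell_j+\sum_{j\in N}x_j$. *)

(* Defs.v *)
From HB Require Import structures.
From mathcomp Require Import all_boot all_order all_algebra.
From mathcomp Require Import all_classical all_reals all_analysis.
Set Implicit Arguments.
Unset Strict Implicit.
Unset Printing Implicit Defensive.
Import Order.TTheory GRing.Theory Num.Theory.
Import numFieldNormedType.Exports.
Local Open Scope classical_set_scope.
Local Open Scope ring_scope.

(* Agents are the elements of 'I_n, ordered as naturals.  Functions on the
   nonnegative half-line are total functions R -> R whose values at negative
   arguments are unconstrained: they are only evaluated at nonnegative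
   points. *)

Definition strictly_concave_nonneg (R : realType) (f : R -> R) : Prop :=
  forall x y t : R, 0 <= x -> 0 <= y -> x != y -> 0 < t -> t < 1 ->
    t * f x + (1 - t) * f y < f (t * x + (1 - t) * y).

Record is_technology (R : realType) (f : R -> R) : Prop := {
  tech_range : forall x : R, 0 <= x -> 0 <= f x <= 1 ;
  tech_increasing : forall x y : R, 0 <= x -> x < y -> f x < f y ;
  tech_concave : strictly_concave_nonneg f ;
  tech_continuous : {within `[0, +oo[, continuous f} ;
  tech_derivable : forall x : R, 0 < x -> derivable f x 1 ;
  tech_zero : f 0 = 0 ;
  tech_inada : derive1 f x @[x --> 0^'+] --> +oo }.

Definition is_problem (R : realType) (n : nat)
    (l : 'I_n -> R) (p : 'I_n -> R -> R) : Prop :=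
  (forall i, 0 < l i) /\ (forall i, is_technology (p i)).

Definition is_profile (R : realType) (n : nat) (x : 'I_n -> R) : Prop :=
  forall i, 0 <= x i.

Record is_solution (R : realType) (n : nat)
    (l : 'I_n -> R) (phi : 'I_n -> 'I_n -> R) : Prop := {
  sol_nonneg : forall i j, 0 <= phi i j ;
  sol_upstream : forall i j : 'I_n, (j < i)%N -> phi i j = 0 ;
  sol_balance : forall i : 'I_n,
    \sum_(j < n | (i <= j)%N) phi i j = \sum_(j < n | (i <= j)%N) l j }.

Definition agent_cost (R : realType) (n : nat) (p : 'I_n -> R -> R)
    (phi : 'I_n -> 'I_n -> R) (k : 'I_n) (x : 'I_n -> R) : R :=
  \sum_(j < n | (j < k)%N)
     (\prod_(i < n | (i < j)%N) p i (x i)) * (1 - p j (x j)) * phi j k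
  + (\prod_(i < n | (i < k)%N) p i (x i)) * (1 - p k (x k)) * phi k k
  + x k.

Definition is_nash (R : realType) (n : nat) (p : 'I_n -> R -> R)
    (phi : 'I_n -> 'I_n -> R) (x : 'I_n -> R) : Prop :=
  is_profile x /\
  forall (k : 'I_n) (y : R), 0 <= y ->
    agent_cost p phi k x <= agent_cost p phi k [eta x with k |-> y].

Definition implements (R : realType) (n : nat) (p : 'I_n -> R -> R)
    (phi : 'I_n -> 'I_n -> R) (x : 'I_n -> R) : Prop :=
  is_nash p phi x /\ forall y : 'I_n -> R, is_nash p phi y -> y = x.

Definition total_cost (R : realType) (n : nat)
    (l : 'I_n -> R) (p : 'I_n -> R -> R) (x : 'I_n -> R) : R :=
  \sum_(j < n) (1 - \prod_(i < n | (i <= j)%N) p i (x i)) * l j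
  + \sum_(j < n) x j.

Definition is_efficient (R : realType) (n : nat)
    (l : 'I_n -> R) (p : 'I_n -> R -> R) (x : 'I_n -> R) : Prop :=
  is_profile x /\
  forall y : 'I_n -> R, is_profile y -> total_cost l p x <= total_cost l p y.

(* Main.v *)
(* In the game induced by phi, agent k minimizes y - a p_k(y), where a is the
   probability that all upstream agents succeed times phi(k,k); along the k-th
   coordinate, the total cost is, up to a constant, y - b p_k(y), where b is the
   same probability times the expected loss downstream of k.  If phi(k,k) is the
   downstream loss at x*, then a = b and x* is a Nash equilibrium.  Conversely,
   if x*_k minimizes both functions, then the Inada condition gives x*_k > 0 (so
   that all success probabilities at x* are positive) and the first-order
   condition a p_k'(x*_k) = 1 = b p_k'(x*_k) gives a = b. *)
Require Import Defs.
From HB Require Import structures.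
From mathcomp Require Import all_boot all_order all_algebra.
From mathcomp Require Import all_classical all_reals all_analysis.
From mathcomp Require Import ring lra.
Set Implicit Arguments.
Unset Strict Implicit.
Unset Printing Implicit Defensive.
Import Order.TTheory GRing.Theory Num.Theory.
Local Open Scope ring_scope.

(** * Minimizers of the scalar cost [y - a * f y] on the half-line *)

Section SingleAgent.
Import numFieldNormedType.Exports.
Local Open Scope classical_set_scope.
Context {R : realType}.
Implicit Types (f : R -> R) (a b x y : R).

Definition minimizes_net_cost f a x : Prop :=
  0 <= x /\ forall y, 0 <= y -> x - a * f x <= y - a * f y.

(** If [a > 0], strict concavity makes the midpoint of two distinct minimizers strictly cheaper; if
    [a = 0], each minimizer is at most the other. *)
Lemma minimizes_net_cost_unique f a x y :
  strictly_concave_nonneg f -> 0 <= a ->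
  minimizes_net_cost f a x -> minimizes_net_cost f a y -> x = y.
Proof.
move=> f_conc a_ge0 [x_ge0 xmin] [y_ge0 ymin].
have [//|neq_xy] := eqVneq x y.
have [a0|a_neq0] := eqVneq a 0.
  by have := xmin y y_ge0; have := ymin x x_ge0; rewrite a0; lra.
have a_gt0 : 0 < a by rewrite lt_def a_neq0.
have half_gt0 : 0 < 2^-1 :> R by lra.
have half_lt1 : 2^-1 < 1 :> R by lra.
have := f_conc x y 2^-1 x_ge0 y_ge0 neq_xy half_gt0 half_lt1.
set m := _ + (1 - _) * y => fm.
have m_ge0 : 0 <= m by rewrite /m; lra.
have mE : m = (x + y) / 2 by rewrite /m; lra.
have := xmin m m_ge0; have := ymin m m_ge0.
have := fm; rewrite -(ltr_pM2l a_gt0).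
rewrite mulrDr (mulrCA a 2^-1) (mulrCA a (1 - _)).
by lra.
Qed.

Lemma minimizes_net_cost_foc f a x :
  (forall z : R, 0 < z -> derivable f z 1) -> 0 < x ->
  minimizes_net_cost f a x -> a * derive1 f x = 1.
Proof.
move=> f_der x_gt0 [_ xmin].
pose g := fun z : R => z - a * f z.
have g_der (z : R) : 0 < z -> is_derive z 1 g (1 - a * derive1 f z).
  move=> z_gt0.
  have f_is : is_derive z 1 f (derive1 f z).
    by rewrite derive1E; apply: DeriveDef => //; exact: f_der.
  by apply: is_deriveB.
have x_in : x \in `]0, (x + 1)[%R by rewrite in_itv /=; lra.
have g0 : is_derive x 1 g 0.
  apply: (@derive1_at_min _ g 0 (x + 1)) => //.
  - by lra.
  - move=> z; rewrite in_itv /= => /andP[z_gt0 _].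
    by have [] := g_der z z_gt0.
  - by move=> z; rewrite in_itv /= => /andP[/ltW + _]; exact: xmin.
have [_ e1] := g_der x x_gt0; have [_ e2] := g0.
by have := etrans (esym e1) e2; lra.
Qed.

(** At 0 the cost is 0. The Inada condition gives slope above [a^-1] near 0, so by the mean value
    theorem a small investment has negative cost. *)
Lemma minimizes_net_cost_gt0 f a x :
  is_technology f -> 0 < a -> minimizes_net_cost f a x -> 0 < x.
Proof.
move=> f_tech a_gt0 [x_ge0 xmin].
rewrite lt_def x_ge0 andbT; apply/eqP => x0; subst x.
have := tech_inada f_tech => /cvgryPgt/(_ a^-1).
case=> /= e e_gt0 f'_gt.
have e2_gt0 : 0 < e / 2 by lra.
have f_cont : {within `[0, e / 2], continuous f}.
  apply: continuous_subspaceW (tech_continuous f_tech) => z /=.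
  by rewrite !in_itv /= => /andP[->].
have [|c c_in fE] := @MVT _ f (derive1 f) 0 (e / 2) e2_gt0 _ f_cont.
  move=> z; rewrite in_itv /= => /andP[z_gt0 _].
  by rewrite derive1E; apply: DeriveDef => //; exact: (tech_derivable f_tech).
move: c_in; rewrite in_itv /= => /andP[c_gt0 c_lt].
have f'c : a^-1 < derive1 f c.
  by apply: f'_gt => //=; rewrite sub0r normrN gtr0_norm //; lra.
have := xmin (e / 2) (ltW e2_gt0).
move: fE; rewrite (tech_zero f_tech) !subr0 mulr0 subr0 => ->.
have : 1 < a * derive1 f c by rewrite -(mulfV (lt0r_neq0 a_gt0)) ltr_pM2l.
rewrite mulrA -(ltr_pM2r e2_gt0); lra.
Qed.

(** Positivity of [b] makes [x] interior, so both first-order conditions hold there; the one for [b]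
    shows that the derivative is nonzero and can be cancelled. *)
Lemma minimizes_net_cost_inj f a b x :
  is_technology f -> 0 < b ->
  minimizes_net_cost f a x -> minimizes_net_cost f b x -> a = b.
Proof.
move=> f_tech b_gt0 xa xb.
have x_gt0 := minimizes_net_cost_gt0 f_tech b_gt0 xb.
have fa := minimizes_net_cost_foc (tech_derivable f_tech) x_gt0 xa.
have fb := minimizes_net_cost_foc (tech_derivable f_tech) x_gt0 xb.
apply: (@mulIf _ (derive1 f x)); last by rewrite fa fb.
by apply/eqP => f'0; move: fb; rewrite f'0 mulr0 => /esym/eqP; rewrite oner_eq0.
Qed.

End SingleAgent.

(** * Reduction of the game and of efficiency to scalar problems *)

Section Game.
Context {R : realType} {n : nat}.
Implicit Types (l x : 'I_n -> R) (p : 'I_n -> R -> R) (phi : 'I_n -> 'I_n -> R).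
Implicit Types (k : 'I_n) (y : R).

Definition reach_prob p x k : R := \prod_(i < n | (i < k)%N) p i (x i).

(** Expected loss averted by the success of [k], given that all upstream agents succeed; written in
    the form that the theorem prescribes for [phi k k]. *)
Definition downstream_loss l p x k : R :=
  l k + \sum_(j < n | (k < j)%N)
          (\prod_(i < n | (k < i <= j)%N) p i (x i)) * l j.

Lemma updE x k y i : i != k -> [eta x with k |-> y] i = x i.
Proof. by move=> /negbTE /= ->. Qed.

(** The terms for [j < k] do not involve the choice of [k], and the last term is affine in [p k];
    the constants cancel in the difference. *)
Lemma agent_cost_upd p phi k x y :
  agent_cost p phi k [eta x with k |-> y] - agent_cost p phi k x =
  (y - reach_prob p x k * phi k k * p k y)
  - (x k - reach_prob p x k * phi k k * p k (x k)).
Proof.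
have ltk (i j : 'I_n) : (i < j)%N -> (j <= k)%N -> i != k.
  by move=> lt_ij le_jk; apply: contraTneq (leq_trans lt_ij le_jk) => ->; rewrite ltnn.
rewrite /agent_cost -/(reach_prob p x k).
have prodE (j : 'I_n) : (j <= k)%N ->
    \prod_(i < n | (i < j)%N) p i ([eta x with k |-> y] i)
    = \prod_(i < n | (i < j)%N) p i (x i).
  by move=> le_jk; apply: eq_bigr => i lt_ij; rewrite updE //; exact: ltk le_jk.
rewrite prodE // -/(reach_prob p x k).
under eq_bigr => j lt_jk.
  rewrite prodE ?(ltnW lt_jk) // updE; last exact: ltk lt_jk _.
  over.
by rewrite /= eqxx; ring.
Qed.

Lemma prod_through p x k (j : 'I_n) : (k <= j)%N ->
  \prod_(i < n | (i <= j)%N) p i (x i) =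
  reach_prob p x k * p k (x k) * \prod_(i < n | (k < i <= j)%N) p i (x i).
Proof.
move=> le_kj; rewrite (bigID (fun i : 'I_n => (i < k)%N)) /= -mulrA; congr (_ * _).
  apply: eq_bigl => i; case: (ltnP i k) => [lt_ik|]; rewrite ?andbF // andbT.
  by rewrite (leq_trans (ltnW lt_ik) le_kj).
rewrite (bigD1 k) /= ?ltnn ?le_kj //; congr (_ * _); apply: eq_bigl => i.
have -> : (i != k) = (val k != val i) by rewrite eq_sym.
by rewrite -leqNgt -andbA [RHS]andbC ltn_neqAle [X in _ = _ && X]andbC.
Qed.

Lemma downstream_lossE l p x k : downstream_loss l p x k =
  \sum_(j < n | (k <= j)%N) (\prod_(i < n | (k < i <= j)%N) p i (x i)) * l j.
Proof.
rewrite /downstream_loss [RHS](bigD1 k) //=; congr (_ + _).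
  rewrite big_pred0 ?mul1r // => i; by rewrite ltnNge andNb.
by apply: eq_bigl => j; rewrite andbC ltn_neqAle eq_sym.
Qed.

Lemma total_cost_upd l p k x y :
  total_cost l p [eta x with k |-> y] - total_cost l p x =
  (y - reach_prob p x k * downstream_loss l p x k * p k y)
  - (x k - reach_prob p x k * downstream_loss l p x k * p k (x k)).
Proof.
set x' := [eta x with k |-> y].
(* Only the last summand depends on [z k]: losses before [k] ignore it, and for each loss from [k]
   on [prod_through] factors out [p k (z k)]. *)
have costE z : (forall i, i != k -> z i = x i) -> total_cost l p z =
   \sum_(j < n | (j < k)%N) (1 - \prod_(i < n | (i <= j)%N) p i (x i)) * l j
   + \sum_(j < n | (k <= j)%N) l j + \sum_(j < n | j != k) x j
   + (z k - reach_prob p x k * downstream_loss l p x k * p k (z k)).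
  move=> zx; rewrite /total_cost (bigID (fun j : 'I_n => (j < k)%N)) /=.
  have -> : \sum_(j < n | (j < k)%N) (1 - \prod_(i < n | (i <= j)%N) p i (z i)) * l j
     = \sum_(j < n | (j < k)%N) (1 - \prod_(i < n | (i <= j)%N) p i (x i)) * l j.
    apply: eq_bigr => j lt_jk; congr ((1 - _) * _).
    apply: eq_bigr => i le_ij; rewrite zx //.
    by apply: contraTneq (leq_ltn_trans le_ij lt_jk) => ->; rewrite ltnn.
  rewrite [\sum_j z j](bigD1 k) //= [\sum_(j | j != k) z j](eq_bigr _ zx).
  have -> : \sum_(j < n | ~~ (j < k)%N)
      (1 - \prod_(i < n | (i <= j)%N) p i (z i)) * l j
     = \sum_(j < n | (k <= j)%N) l j
       - reach_prob p x k * downstream_loss l p x k * p k (z k).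
    rewrite downstream_lossE mulrAC mulr_sumr -sumrB.
    apply: eq_big => [j|j]; first by rewrite -leqNgt.
    rewrite -leqNgt => le_kj; rewrite (prod_through _ _ le_kj).
    (* The remaining factors come from agents other than [k], where [z] agrees with [x]. *)
    have -> : reach_prob p z k = reach_prob p x k.
      apply: eq_bigr => i lt_ik; rewrite zx //.
      by apply: contraTneq lt_ik => ->; rewrite ltnn.
    rewrite (eq_bigr (fun i => p i (x i))) => [|i /andP[lt_ki _]]; first by ring.
    by rewrite zx //; apply: contraTneq lt_ki => ->; rewrite ltnn.
  by ring.
rewrite (costE x') => [|i]; last exact: updE.
by rewrite (costE x) // /x' /= eqxx; ring.
Qed.

Lemma is_nashE p phi x : is_nash p phi x <->
  forall k, minimizes_net_cost (p k) (reach_prob p x k * phi k k) (x k).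
Proof.
split=> [[x_ge0 xmin] k|xmin].
  split=> [|y y_ge0]; first exact: x_ge0.
  by have := xmin k y y_ge0; rewrite -subr_ge0 agent_cost_upd subr_ge0.
split=> [k|k y y_ge0]; first by have [] := xmin k.
by rewrite -subr_ge0 agent_cost_upd subr_ge0; have [_] := xmin k; exact.
Qed.

Lemma efficient_minimizes l p x k : is_efficient l p x ->
  minimizes_net_cost (p k) (reach_prob p x k * downstream_loss l p x k) (x k).
Proof.
move=> [x_ge0 xmin]; split=> [|y y_ge0]; first exact: x_ge0.
rewrite -subr_ge0 -total_cost_upd subr_ge0; apply: xmin => i /=.
by case: ifP.
Qed.

Lemma reach_prob_ge0 p x k : (forall i, is_technology (p i)) ->
  is_profile x -> 0 <= reach_prob p x k.
Proof.
move=> tech x_ge0; apply: prodr_ge0 => i _.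
by have /andP[] := tech_range (tech i) (x_ge0 i).
Qed.

Lemma downstream_loss_gt0 l p x k : is_problem l p -> is_profile x ->
  0 < downstream_loss l p x k.
Proof.
move=> [l_gt0 tech] x_ge0; apply: ltr_pwDl; first exact: l_gt0.
apply: sumr_ge0 => j _; apply: mulr_ge0; last exact: ltW.
by apply: prodr_ge0 => i _; have /andP[] := tech_range (tech i) (x_ge0 i).
Qed.

(* The best response of an agent is unique and depends on upstream agents only,
   so the equality of two equilibria propagates downstream. *)
Lemma nash_unique p phi x x' : (forall i, is_technology (p i)) ->
  (forall i, 0 <= phi i i) -> is_nash p phi x -> is_nash p phi x' -> x = x'.
Proof.
move=> tech phi_ge0 x_nash x'_nash; apply/funext => k.
have [m le_km] := ubnP (k : nat); elim: m => // m IHm in k le_km *.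
have reachE : reach_prob p x' k = reach_prob p x k.
  by apply: eq_bigr => i lt_ik; rewrite IHm // (leq_trans lt_ik).
apply: (@minimizes_net_cost_unique _ (p k) (reach_prob p x k * phi k k)).
- exact: tech_concave.
- by apply: mulr_ge0 => //; apply: reach_prob_ge0 => //; case: x_nash.
- exact: (is_nashE _ _ _).1.
- by rewrite -reachE; exact: (is_nashE _ _ _).1.
Qed.

(** Strong induction on [k]: an upstream agent reached with positive probability has a positive
    coefficient, hence invests and succeeds with positive probability. *)
Lemma efficient_reach_prob_gt0 l p x k : is_problem l p ->
  is_efficient l p x -> 0 < reach_prob p x k.
Proof.
move=> prob x_eff; have [_ tech] := prob; have [x_ge0 _] := x_eff.
have [m le_km] := ubnP (k : nat); elim: m => // m IHm in k le_km *.
apply: prodr_gt0 => i lt_ik.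
rewrite -(tech_zero (tech i)); apply: tech_increasing => //.
apply: minimizes_net_cost_gt0 (efficient_minimizes i x_eff) => //.
apply: mulr_gt0; last exact: downstream_loss_gt0.
by apply: IHm; rewrite (leq_trans lt_ik).
Qed.

End Game.

Theorem theorem1 (R : realType) (n : nat)
    (l : 'I_n -> R) (p : 'I_n -> R -> R)
    (xs : 'I_n -> R) (phi : 'I_n -> 'I_n -> R)
    (hproblem : is_problem l p)
    (heff : is_efficient l p xs)
    (hsol : is_solution l phi) :
  implements p phi xs <->
  forall i : 'I_n,
    phi i i = l i +
      \sum_(k < n | (i < k)%N)
         (\prod_(j < n | (i < j <= k)%N) p j (xs j)) * l k.
Proof.
have [_ tech] := hproblem; have [xs_ge0 _] := heff.
split=> [[/is_nashE xs_nash _] k|phiE].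
  have reach_gt0 := efficient_reach_prob_gt0 k hproblem heff.
  (* The scalar problems determine [phi k k] only up to the factor [reach_prob], which is cancelled
     here. *)
  apply: (mulfI (lt0r_neq0 reach_gt0)).
  apply: minimizes_net_cost_inj (xs_nash k) (efficient_minimizes k heff) => //.
  by apply: mulr_gt0 => //; exact: downstream_loss_gt0.
have xs_nash : is_nash p phi xs.
  (* After [phiE] the equilibrium and efficiency coefficients coincide. *)
  by apply/is_nashE => k; rewrite phiE; exact: efficient_minimizes.
split=> // y y_nash; apply: nash_unique y_nash xs_nash => // i.
exact: (sol_nonneg hsol).
Qed.
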